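(* Let $Z$ be a bounded metric space with at least two points and finite capacity dimension $n=\operatorname{cdim}Z$. Then there is $r_0>0$ such that for every $r\in(0,r_0)$ there exists a sequence $(\mathcal U_j)_{j\ge0}$ of $(n+1)$-colored (by a set $C$, $|C|=n+1$) open coverings $\mathcal U_j=\bigcup_{c\in C}\mathcal U_j^c$ of $Z$ such that, for any hyperbolic approximation $X$ of $Z$ with parameter $r$, the following hold: (1) $\mathcal U_0^c=\{Z\}$ for all $c\in C$, and $\operatorname{mesh}\mathcal U_j<r^j$ for every $j\ge1$; (2) for every $v\in V_{j+1}$, $j\ge0$, there is $U\in\mathcal U_j$ with $B(v)\subset U$; (3) (separation) for every $c\in C$ and different members $U\in\mathcal U_j^c$, $U'\in\mathcal U_{j'}^c$ with $j'\le j$: setting $B(U)=\bigcup\{B(v):v\in V_{j+1},\ B(v)\cap U\neq\emptyset\}$, either $B(U)\subset U'$ or $B(U)\cap U'=\emptyset$.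
   Context: For a family $\mathcal U$ of subsets of a metric space $Z$, $\operatorname{mesh}\mathcal U=\sup_{U\in\mathcal U}\operatorname{diam}U$. An open covering $\mathcal U$ is $m$-colored if $\mathcal U=\bigcup_{c\in C}\mathcal U^c$ with $|C|=m$ and each $\mathcal U^c$ consists of pairwise disjoint sets. For an open covering, $L(\mathcal U,z)=\min\{\sup_{U\in\mathcal U}\operatorname{dist}(z,Z\setminus U),\operatorname{mesh}\mathcal U\}$, $L(\mathcal U)=\inf_zL(\mathcal U,z)$. The capacity dimension $\operatorname{cdim}Z$ is the minimal integer $m\ge0$ such that there is $\delta>0$ so that for every sufficiently small $\tau>0$ there exists an $(m+1)$-colored open covering $\mathcal U$ of $Z$ with $\operatorname{mesh}\mathcal U\le\tau$ and $L(\mathcal U)\ge\delta\tau$. Hyperbolic approximation with parameter $r\in(0,1/6]$: let $k_0$ be the largest integer with $\operatorname{diam}Z<r^{k_0}$; for each integer $k\ge k_0$ choose a maximal $r^k$-separated subset $V_k\subset Z$; the vertex set is $V=\bigsqcup_{k\ge k_0}V_k$, and to $v\in V_k$ is associated the open ball $B(v)=\{z\in Z:d(z,v)<2r^k\}$. (Edges: equal-level vertices with intersecting closed balls, or vertices on adjacent levels with the higher-level ball contained in the lower-level ball; unit edge lengths.) *)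

(* Defs.v *)
From HB Require Import structures.
From mathcomp Require Import all_boot all_order all_algebra.
From mathcomp Require Import all_classical all_reals ereal.
Set Implicit Arguments. Unset Strict Implicit. Unset Printing Implicit Defensive.
Import Order.TTheory GRing.Theory Num.Theory.
Local Open Scope classical_set_scope.
Local Open Scope ring_scope.

Section MetricDefs.
Variables (R : realType) (T : Type) (d : T -> T -> R).

Definition is_metric : Prop :=
  [/\ forall x y, 0 <= d x y,
      forall x y, d x y = 0 <-> x = y,
      forall x y, d x y = d y x &
      forall x y z, d x z <= d x y + d y z].

Definition bounded_space : Prop := exists M : R, forall x y, d x y <= M.

Definition open_set (U : set T) : Prop :=
  forall x, U x -> exists e : R, 0 < e /\ [set y | d x y < e] `<=` U.

Definition diam (U : set T) : \bar R :=
  ereal_sup [set (d x y)%:E | x in U & y in U].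

Definition mesh (F : set (set T)) : \bar R :=
  ereal_sup [set diam U | U in F].

(* distance from a point to a set (+oo for the empty set) *)
Definition dist_to (z : T) (A : set T) : \bar R :=
  ereal_inf [set (d z a)%:E | a in A].

(* a family indexed by colours in 'I_m: the covering is the union of all colours *)
Definition union_fam m (F : 'I_m -> set (set T)) : set (set T) :=
  [set U | exists c, F c U].

Definition colored_open_covering m (F : 'I_m -> set (set T)) : Prop :=
  [/\ forall c U, F c U -> open_set U,
      forall z : T, exists c U, F c U /\ U z &
      forall c U U', F c U -> F c U' -> U <> U' -> U `&` U' = set0].

Definition Leb_at m (F : 'I_m -> set (set T)) (z : T) : \bar R :=
  Order.min (ereal_sup [set dist_to z (~` U) | U in union_fam F])
            (mesh (union_fam F)).

Definition Leb m (F : 'I_m -> set (set T)) : \bar R :=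
  ereal_inf [set Leb_at F z | z in [set: T]].

Definition cdim_prop (m : nat) : Prop :=
  exists delta : R, 0 < delta /\
  exists tau0 : R, 0 < tau0 /\
  forall tau : R, 0 < tau -> tau < tau0 ->
    exists F : 'I_m.+1 -> set (set T),
      [/\ colored_open_covering F,
          (mesh (union_fam F) <= tau%:E)%E &
          ((delta * tau)%:E <= Leb F)%E].

Definition cdim_eq (n : nat) : Prop :=
  cdim_prop n /\ forall m, (m < n)%N -> ~ cdim_prop m.

(* hyperbolic approximation with parameter r: the family of levels V k
   (k : int); V k is empty for k < k0, and a maximal r^k-separated set for k >= k0 *)
Definition separated (s : R) (A : set T) : Prop :=
  forall x y, A x -> A y -> x <> y -> s <= d x y.

Definition maximal_separated (s : R) (A : set T) : Prop :=
  separated s A /\ forall A', A `<=` A' -> separated s A' -> A' = A.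

Definition is_k0 (r : R) (k0 : int) : Prop :=
  (diam [set: T] < (r ^ k0)%:E)%E /\
  forall k : int, (diam [set: T] < (r ^ k)%:E)%E -> k <= k0.

Definition hyp_approx (r : R) (V : int -> set T) : Prop :=
  [/\ 0 < r, r <= 6^-1 &
      exists k0, is_k0 r k0 /\
        forall k : int, (k < k0 -> V k = set0) /\
                        (k0 <= k -> maximal_separated (r ^ k) (V k))].

Definition Bv (r : R) (k : int) (v : T) : set T :=
  [set z | d z v < 2 * r ^ k].

Definition BU (r : R) (V : int -> set T) (j : nat) (U : set T) : set T :=
  [set z | exists v, V (Posz j.+1) v /\ Bv r (Posz j.+1) v `&` U !=set0 /\
                     Bv r (Posz j.+1) v z].

End MetricDefs.

(* Main.v *)
Require Import Defs.
From HB Require Import structures.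
From mathcomp Require Import all_boot all_order all_algebra.
From mathcomp Require Import all_classical all_reals ereal.
From mathcomp Require Import lra.
Set Implicit Arguments. Unset Strict Implicit. Unset Printing Implicit Defensive.
Import Order.TTheory GRing.Theory Num.Theory.
Local Open Scope classical_set_scope.
Local Open Scope ring_scope.

(** Take coverings [W j] of mesh [<= r ^+ j / 4] coming from the capacity
    dimension and shrink their members, so that members of the same colour lie
    at distance [>= 11 * r ^+ j.+1] while every ball of radius [2 * r ^+ j.+1]
    still fits in a member.  For a fixed colour, call two points [i]-linked if
    they are joined by a chain of [5 * r ^+ j.+1]-neighbourhoods of members of
    the levels [j > i].  Separation prevents a chain from visiting two members
    of its coarsest level, so linked points are at distance [<= r ^+ i.+1].
    The required covering of level [i] is made of the saturations of the members
    of [W i]: a saturated set either contains or misses each of the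
    neighbourhoods of finer level, and these neighbourhoods contain the [B(U)]. *)

Section Saturation.
Variables (R : realType) (T : Type) (d : T -> T -> R).
Hypothesis dM : is_metric d.

(** * Neighbourhoods, shrinking, mesh and Lebesgue number *)

Definition nbhd_of (e : R) (A : set T) : set T :=
  [set z | exists2 w, A w & d z w < e].

Lemma metric_xx x : d x x = 0.
Proof. by case: dM => _ /(_ x x)[_ h] _ _; apply: h. Qed.

Lemma metric_sym x y : d x y = d y x.
Proof. by case: dM => _ _ h _; apply: h. Qed.

Lemma metric_triangle y x z : d x z <= d x y + d y z.
Proof. by case: dM => _ _ _; apply. Qed.

Lemma sub_nbhd_of e A : 0 < e -> A `<=` nbhd_of e A.
Proof. by move=> e0 x Ax; exists x; rewrite ?metric_xx. Qed.

Lemma open_ball x (e : R) : open_set d [set y | d x y < e].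
Proof.
move=> y /= ye; exists (e - d x y); split; first by lra.
by move=> z /= yz; have := metric_triangle y x z; lra.
Qed.

Lemma open_nbhd_of e A : open_set d (nbhd_of e A).
Proof.
move=> x [w Aw]; rewrite metric_sym => /(@open_ball w e)[h [h0 sub]].
by exists h; split=> // y /sub /= wy; exists w => //; rewrite metric_sym.
Qed.

(** The points at distance greater than [a] from the complement of [U]; asking for a radius [e]
    beyond [a] keeps this set open. *)
Definition shrink (a : R) (U : set T) : set T :=
  [set x | exists e, a < e /\ [set y | d x y < e] `<=` U].

Lemma open_shrink a U : open_set d (shrink a U).
Proof.
move=> x [e [ae sub]]; exists ((e - a) / 2); split; first by lra.
move=> y /= xy; exists ((e + a) / 2); split; first by lra.
by move=> z /= yz; apply: sub => /=; have := metric_triangle y x z; lra.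
Qed.

Lemma shrink_sub a U : 0 <= a -> shrink a U `<=` U.
Proof. by move=> a0 x [e [ae]]; apply => /=; rewrite metric_xx; lra. Qed.

Lemma shrink_separated a U U' x y : 0 <= a -> U `&` U' = set0 ->
  shrink a U x -> shrink a U' y -> a <= d x y.
Proof.
move=> a0 dis [e [ae sub]] /(shrink_sub a0) U'y.
rewrite leNgt; apply/negP => xy.
suff : (U `&` U') y by rewrite dis.
by split=> //; apply: sub => /=; lra.
Qed.

Lemma ball_sub_shrink a b e U z : a + b < e ->
  [set y | d z y < e] `<=` U -> [set y | d z y < b] `<=` shrink a U.
Proof.
move=> abe sub y /= zy; exists (e - b); split; first by lra.
by move=> x /= yx; apply: sub => /=; have := metric_triangle y z x; lra.
Qed.

Lemma dist_le_diam (U : set T) x y (t : R) :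
  (diam d U <= t%:E)%E -> U x -> U y -> d x y <= t.
Proof.
move=> h Ux Uy; rewrite -lee_fin; apply: le_trans h.
by apply: ereal_sup_ubound; exists x => //; exists y.
Qed.

Lemma dist_le_mesh (F : set (set T)) U x y (t : R) :
  (mesh d F <= t%:E)%E -> F U -> U x -> U y -> d x y <= t.
Proof.
move=> h FU; apply: dist_le_diam; apply: le_trans h.
by apply: ereal_sup_ubound; exists U.
Qed.

Lemma mesh_le (F : set (set T)) (t : R) :
  (forall U x y, F U -> U x -> U y -> d x y <= t) -> (mesh d F <= t%:E)%E.
Proof.
move=> h; apply: ge_ereal_sup => _ [U FU <-].
apply: ge_ereal_sup => _ [x Ux [y Uy <-]].
by rewrite lee_fin; apply: h FU Ux Uy.
Qed.

(** The supremum in [Leb_at] exceeds [e], so the complement of some member is farther than [e] from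
    [z]. *)
Lemma Leb_ball m (F : 'I_m -> set (set T)) (e l : R) z : e < l ->
  (l%:E <= Leb d F)%E -> exists c U, F c U /\ [set y | d z y < e] `<=` U.
Proof.
move=> el lF.
have : (e%:E < ereal_sup [set dist_to d z (~` U) | U in union_fam F])%E.
  apply: (@lt_le_trans _ _ l%:E); first by rewrite lte_fin.
  apply: (le_trans lF); apply: (@le_trans _ _ (Leb_at d F z)).
    by apply: ereal_inf_lbound; exists z.
  by rewrite /Leb_at ge_min lexx.
move=> /ereal_sup_gt[_ [U [c FcU] <-] eU]; exists c, U; split=> // y /= zy.
apply: contrapT => nUy; move: eU; apply/negP; rewrite -leNgt.
apply: (@le_trans _ _ (d z y)%:E); last by rewrite lee_fin ltW.
by apply: ereal_inf_lbound; exists y.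
Qed.

(** A covering of mesh at most [t / 4] is shrunk by [11 * (r * t)], which separates equal colours.
    Balls of radius [2 * (r * t)] survive if the Lebesgue bound [delta * (t / 4)] exceeds
    [13 * (r * t)], whence [r < delta / 52]. *)
Lemma cdim_separated_covering n : cdim_prop d n ->
  exists2 r0 : R, 0 < r0 & forall r t, 0 < r < r0 -> 0 < t <= r ->
    exists F : 'I_n.+1 -> set (set T),
    [/\ forall c U, F c U -> open_set d U,
        forall c U x y, F c U -> U x -> U y -> d x y <= t / 4,
        forall c U U' x y, F c U -> F c U' -> U <> U' -> U x -> U' y ->
          11 * (r * t) <= d x y &
        forall z, exists c U, F c U /\ [set y | d z y < 2 * (r * t)] `<=` U].
Proof.
move=> [delta [delta0 [tau0 [tau00 cov]]]].
exists (Num.min tau0 (delta / 52)).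
  by rewrite lt_min tau00 /=; lra.
move=> r t /andP[r0]; rewrite lt_min => /andP[rtau rdelta] /andP[t0 tr].
have [||F [[_ _ disF] meshF LebF]] := cov (t / 4); [lra|lra|].
have rt0 : 0 < r * t by exact: mulr_gt0.
have rtd : r * t < delta / 52 * t by rewrite ltr_pM2r.
exists (fun c => [set shrink (11 * (r * t)) U | U in F c]); split.
- by move=> c _ [U _ <-]; exact: open_shrink.
- move=> c _ x y [U FU <-] /shrink_sub Ux /shrink_sub Uy.
  by apply: (dist_le_mesh meshF (U := U)); [exists c| apply: Ux; lra| apply: Uy; lra].
- move=> c _ _ x y [U FU <-] [U' FU' <-] ne Ux U'y.
  apply: shrink_separated Ux U'y; first by lra.
  by apply: disF FU FU' _ => UU'; apply: ne; rewrite UU'.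
- move=> z.
  (* The midpoint of [13 * (r * t)] and the Lebesgue bound: strict inequalities are needed on both
     sides. *)
  pose e := (13 * (r * t) + delta * (t / 4)) / 2.
  have [|c [U [FU sub]]] := @Leb_ball _ F e _ z _ LebF; first by rewrite /e; lra.
  exists c, (shrink (11 * (r * t)) U); split; first by exists U.
  by apply: ball_sub_shrink sub; rewrite /e; lra.
Qed.

(** * A single colour: chains and saturations *)

Variables (r : R) (W : nat -> set (set T)).
Hypotheses (r_gt0 : 0 < r) (r_le : r <= 40^-1).
Hypothesis W_open : forall j U, W j U -> open_set d U.
Hypothesis W_mesh : forall j U x y,
  (0 < j)%N -> W j U -> U x -> U y -> d x y <= r ^+ j / 4.
Hypothesis W_sep : forall j U U' x y,
  W j U -> W j U' -> U <> U' -> U x -> U' y -> 11 * r ^+ j.+1 <= d x y.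

(** Here 5 = 1 + 2 + 2: the saturation of [U] stays within [r ^+ j.+1] of [U], and a ball [B(v)]
    meeting it adds less than twice the radius [2 * r ^+ j.+1]. *)
Definition fat (j : nat) (U : set T) : set T := nbhd_of (5 * r ^+ j.+1) U.

Lemma exp_r_gt0 j : 0 < r ^+ j.
Proof. exact: exprn_gt0. Qed.

Lemma exp_rS_le j : r ^+ j.+1 <= r ^+ j / 40.
Proof. by rewrite exprS mulrC ler_pM2l ?exp_r_gt0. Qed.

(* The bound [m] on the levels only serves the induction in [linked_dist]. *)
Inductive linked (i m : nat) (x : T) : T -> Prop :=
| linked_refl : linked i m x x
| linked_step y z j U : linked i m x y -> (i < j <= m)%N -> W j U ->
    fat j U y -> fat j U z -> linked i m x z.

Lemma linked_widen i m m' x y : (m <= m')%N ->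
  linked i m x y -> linked i m' x y.
Proof.
move=> mm'; elim=> [|y' z j U _ IH /andP[ij jm] WU y'U zU].
  exact: linked_refl.
by apply: linked_step IH _ WU y'U zU; rewrite ij (leq_trans jm).
Qed.

Lemma fat_mesh j U x y : (0 < j)%N -> W j U -> fat j U x -> fat j U y ->
  d x y <= r ^+ j / 2.
Proof.
move=> j0 WU [u Uu xu] [v Uv yv].
have := W_mesh j0 WU Uu Uv; have := exp_rS_le j.
have := metric_triangle u x y; have := metric_triangle v u y.
by move: yv; rewrite (metric_sym y v); lra.
Qed.

(** Since 5 + 1 + 5 = 11, distinct members would be closer than [W_sep] allows. *)
Lemma fat_sep j U U' x y : W j U -> W j U' -> fat j U x -> fat j U' y ->
  d x y <= r ^+ j.+1 -> U = U'.
Proof.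
move=> WU WU' [u Uu xu] [v U'v yv] xy; apply: contrapT => ne.
have := W_sep WU WU' ne Uu U'v.
have := metric_triangle x u v; have := metric_triangle y x v.
by rewrite (metric_sym u x); lra.
Qed.

(** Induction on the number [k] of admissible levels, splitting off the coarsest one, [i.+1]. *)
Lemma linked_dist k i x y : linked i (i + k) x y -> d x y <= r ^+ i.+1.
Proof.
elim: k i x y => [|k IH] i x y.
  rewrite addn0; case=> [|? z j U _ /andP[ij /(leq_trans ij)]].
    by rewrite metric_xx ltW ?exp_r_gt0.
  by rewrite ltnn.
rewrite addnS -addSn => lxy.
(* A chain either avoids level [i.+1] or reduces to a finer chain, one jump within a single [fat]
   member of that level, and a finer chain. *)
have: linked i.+1 (i.+1 + k) x y \/
    exists U p q, [/\ W i.+1 U, fat i.+1 U p, fat i.+1 U q,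
      linked i.+1 (i.+1 + k) x p & linked i.+1 (i.+1 + k) q y].
  elim: lxy => [|y' z j U _ IHl /andP[]]; first by left; exact: linked_refl.
  rewrite leq_eqVlt => /predU1P[<- _|ij jm] WU y'U zU.
    right; case: IHl => [xy'|[U' [p [q [WU' pU' qU' xp qy']]]]].
      by exists U, y', z; split=> //; exact: linked_refl.
    (* By induction the finer chain between two visits to level [i.+1] moves at most [r ^+ i.+2],
       too little to change members, so the two jumps merge into one. *)
    have UU' := fat_sep WU' WU qU' y'U (IH _ _ _ qy').
    exists U, p, z; split=> //; last exact: linked_refl.
    by rewrite -UU'.
  have step p : linked i.+1 (i.+1 + k) p y' -> linked i.+1 (i.+1 + k) p z.
    by move=> py'; apply: linked_step py' _ WU y'U zU; rewrite ij.
  case: IHl => [xy'|[U' [p [q [WU' pU' qU' xp qy']]]]]; first by left; exact: step.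
  by right; exists U', p, q; split=> //; exact: step.
(* In the second case the total is at most [r ^+ i.+1 / 2 + 2 * r ^+ i.+2], and [r <= 40^-1] absorbs
   the last term. *)
have rS := exp_rS_le i.+1; have rpos := exp_r_gt0 i.+1.
case=> [/IH|[U [p [q [WU pU qU /IH xp /IH qy]]]]]; first by lra.
have := fat_mesh (ltn0Sn i) WU pU qU.
by have := metric_triangle p x y; have := metric_triangle q p y; lra.
Qed.

(** The bound [m] is existential: each chain is finite, but chains may reach arbitrarily fine
    levels. *)
Definition saturate (i : nat) (U : set T) : set T :=
  [set x | exists w m, U w /\ linked i m w x].

Lemma saturate_near i U x : saturate i U x ->
  exists2 w, U w & d w x <= r ^+ i.+1.
Proof.
move=> [w [m [Uw wx]]]; exists w => //.
by apply: (@linked_dist m); apply: linked_widen wx; exact: leq_addl.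
Qed.

Lemma sub_saturate i U : U `<=` saturate i U.
Proof. by move=> x Ux; exists x, 0%N; split=> //; exact: linked_refl. Qed.

Lemma saturate_fat i j U U' x y : (i < j)%N -> W j U ->
  saturate i U' x -> fat j U x -> fat j U y -> saturate i U' y.
Proof.
move=> ij WU [w [m [U'w wx]]] xU yU; exists w, (maxn m j); split=> //.
apply: (@linked_step _ _ _ x _ j U) => //; last by rewrite ij leq_maxr.
by apply: linked_widen wx; exact: leq_maxl.
Qed.

(** By the last link of the chain, a point lies either in the open set [U] or in an open [fat] set
    of finer level, which the saturation absorbs. *)
Lemma open_saturate i U : W i U -> open_set d (saturate i U).
Proof.
move=> WU x satx; have [w [m [Uw wx]]] := satx; move: wx satx.
case=> [_|y z j U' wy /andP[ij jm] WU' yU' zU' satz].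
  have [e [e0 sub]] := W_open WU Uw.
  by exists e; split=> // y /sub; exact: sub_saturate.
have [e [e0 sub]] := open_nbhd_of zU'.
by exists e; split=> // t /sub tU'; exact: saturate_fat ij WU' satz zU' tU'.
Qed.

Lemma saturate_mesh i U x y : (0 < i)%N -> W i U ->
  saturate i U x -> saturate i U y -> d x y <= r ^+ i / 2.
Proof.
move=> i0 WU /saturate_near[u Uu ux] /saturate_near[v Uv vy].
have := W_mesh i0 WU Uu Uv; have := exp_rS_le i; have := exp_r_gt0 i.
have := metric_triangle u x y; have := metric_triangle v u y.
by rewrite (metric_sym x u); lra.
Qed.

(** The saturation stays within [r ^+ i.+1] of [U'], exactly the slack in [fat_sep]. Enlarging one
    side to [fat] serves both disjointness and separation at equal levels. *)
Lemma saturate_fat_disjoint i U U' : W i U -> W i U' -> U <> U' ->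
  fat i U `&` saturate i U' = set0.
Proof.
move=> WU WU' ne; rewrite -subset0 => x [xU /saturate_near[v U'v vx]].
apply: ne; apply: (fat_sep WU WU' xU _ (y := v)).
  by apply: sub_nbhd_of U'v; have := exp_r_gt0 i.+1; lra.
by rewrite metric_sym.
Qed.

Lemma saturate_sub_fat i U : saturate i U `<=` fat i U.
Proof.
move=> x /saturate_near[w Uw wx]; exists w => //; rewrite metric_sym.
by have := exp_r_gt0 i.+1; lra.
Qed.

Lemma BU_saturate_sub_fat V j U : BU d r V j (saturate j U) `<=` fat j U.
Proof.
move=> z [v [_ [[u [/= uv /saturate_near[w Uw wu]]] zv]]]; exists w => //.
move: uv zv; rewrite /Bv /= -!exprnP => uv zv.
have := metric_triangle v z w; have := metric_triangle u v w.
by rewrite (metric_sym v u) (metric_sym u w); lra.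
Qed.

(** At equal levels the sets are disjoint; a strictly coarser saturation swallows [fat j U] as soon
    as it meets it. *)
Lemma saturate_separation V j j' U U' : (j' <= j)%N -> W j U -> W j' U' ->
  saturate j U <> saturate j' U' ->
  BU d r V j (saturate j U) `<=` saturate j' U' \/
  BU d r V j (saturate j U) `&` saturate j' U' = set0.
Proof.
rewrite leq_eqVlt => /predU1P[->|j'j] WU WU' ne.
  right; rewrite -subset0 => x [/BU_saturate_sub_fat xU xU'].
  suff : (fat j U `&` saturate j U') x.
    by rewrite saturate_fat_disjoint // => UU'; apply: ne; rewrite UU'.
  by [].
have [[x [/BU_saturate_sub_fat xU xU']]|no] :=
  pselect (exists x, (BU d r V j (saturate j U) `&` saturate j' U') x).
  by left=> y /BU_saturate_sub_fat yU; exact: saturate_fat j'j WU xU' xU yU.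
by right; rewrite -subset0 => x Bx; apply: no; exists x.
Qed.

End Saturation.

(** * Assembly over all levels and colours *)

Theorem theorem5p1 (R : realType) (T : Type) (d : T -> T -> R) (n : nat) :
  is_metric d -> bounded_space d -> (exists x y : T, x <> y) -> cdim_eq d n ->
  exists r0 : R, 0 < r0 /\ r0 <= 6^-1 /\
  forall r : R, 0 < r -> r < r0 ->
  exists Ucal : nat -> 'I_n.+1 -> set (set T),
    (forall j, colored_open_covering d (Ucal j)) /\
    forall V : int -> set T, hyp_approx d r V ->
    [/\ (* (1) *)
        (forall c, Ucal 0%N c = [set [set: T]]) /\
        (forall j : nat, (1 <= j)%N -> (mesh d (union_fam (Ucal j)) < (r ^+ j)%:E)%E),
        (* (2) *)
        (forall (j : nat) v, V (Posz j.+1) v ->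
           exists c U, Ucal j c U /\ Bv d r (Posz j.+1) v `<=` U) &
        (* (3) separation *)
        (forall (c : 'I_n.+1) (j j' : nat) (U U' : set T),
           (j' <= j)%N -> Ucal j c U -> Ucal j' c U' -> U <> U' ->
           BU d r V j U `<=` U' \/ BU d r V j U `&` U' = set0)].
Proof.
move=> dM _ _ [/(cdim_separated_covering dM)[r1 r1_gt0 cov] _].
exists (Num.min r1 40^-1); split; first by rewrite lt_min r1_gt0 /=; lra.
split; first by rewrite ge_min; apply/orP; right; lra.
move=> r r_gt0; rewrite lt_min => /andP[rr1 /ltW r_le].
have [W [W0 WS]] : exists W : nat -> 'I_n.+1 -> set (set T),
    (forall c, W 0%N c = [set [set: T]]) /\ forall j,
    [/\ forall c U, W j.+1 c U -> open_set d U,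
        forall c U x y, W j.+1 c U -> U x -> U y -> d x y <= r ^+ j.+1 / 4,
        forall c U U' x y, W j.+1 c U -> W j.+1 c U' -> U <> U' ->
          U x -> U' y -> 11 * r ^+ j.+2 <= d x y &
        forall z, exists c U, W j.+1 c U /\
          [set y | d z y < 2 * r ^+ j.+2] `<=` U].
  have r01 : 0 < r < r1 by rewrite r_gt0.
  have r_pow j : 0 < r ^+ j.+1 <= r.
    by rewrite exprn_gt0 //= exprS ler_piMr ?exprn_ile1 //; lra.
  (* Level [j.+1] uses the scale [t = r ^+ j.+1], so that [r * t] is [r ^+ j.+2]; level 0 is set by
     hand to the whole space in every colour. *)
  have [F FP] := boolp.choice (fun j => cov r (r ^+ j.+1) r01 (r_pow j)).
  exists (fun j => if j is j'.+1 then F j' else fun=> [set [set: T]]).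
  by split=> // j; rewrite (exprS r j.+1); exact: FP.
pose Wc c j := W j c.
have W_open c j U : Wc c j U -> open_set d U.
  case: j => [|j]; last by have [h _ _ _] := WS j; exact: h.
  by rewrite /Wc W0 => -> x _; exists 1.
have W_mesh c j U x y : (0 < j)%N -> Wc c j U -> U x -> U y ->
    d x y <= r ^+ j / 4.
  by case: j => // j _; have [_ h _ _] := WS j; exact: h.
have W_sep c j U U' x y : Wc c j U -> Wc c j U' -> U <> U' -> U x -> U' y ->
    11 * r ^+ j.+1 <= d x y.
  case: j => [|j]; last by have [_ _ h _] := WS j; exact: h.
  (* Level 0 has one member per colour, so no two distinct ones. *)
  by rewrite /Wc W0 => -> ->.
have W_ball j z : exists c U, W j c U /\ [set y | d z y < 2 * r ^+ j.+1] `<=` U.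
  case: j => [|j]; last by have [_ _ _ h] := WS j; exact: h.
  by exists ord0, setT; rewrite W0.
exists (fun j c => [set saturate d r (Wc c) j U | U in Wc c j]); split=> [j|V _].
  split.
  - by move=> c _ [U WU <-]; exact: (open_saturate dM (W_open c)).
  - move=> z; have [c [U [WU sub]]] := W_ball j z.
    exists c, (saturate d r (Wc c) j U); split; first by exists U.
    apply: sub_saturate; apply: sub => /=.
    by rewrite metric_xx // mulr_gt0 // exprn_gt0.
  - move=> c _ _ [U WU <-] [U' WU' <-] ne.
    rewrite -subset0 => x [xU xU'].
    suff : (fat d r j U `&` saturate d r (Wc c) j U') x.
      rewrite (saturate_fat_disjoint dM r_gt0 r_le (W_mesh c) (W_sep c)) //.
      by move=> UU'; apply: ne; rewrite UU'.
    by split=> //; exact: (saturate_sub_fat dM r_gt0 r_le (W_mesh c) (W_sep c)).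
split; first split.
- move=> c; rewrite /Wc W0 image_set1; congr [set _].
  by rewrite -subTset; exact: sub_saturate.
(* The factor 1/2 in [saturate_mesh] yields the strict inequality. *)
- move=> j j0; apply: (@le_lt_trans _ _ (r ^+ j / 2)%:E).
    apply: mesh_le => _ x y [c [U WU <-]].
    exact: (saturate_mesh dM r_gt0 r_le (W_mesh c) (W_sep c) j0 WU).
  by rewrite lte_fin; have := exprn_gt0 j r_gt0; lra.
- move=> j v _; have [c [U [WU sub]]] := W_ball j v.
  exists c, (saturate d r (Wc c) j U); split; first by exists U.
  move=> z zv; apply: sub_saturate; apply: sub => /=.
  by rewrite metric_sym.
- move=> c j j' _ _ j'j [U WU <-] [U' WU' <-].
  exact: (saturate_separation dM r_gt0 r_le (W_mesh c) (W_sep c) V j'j WU WU').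
Qed.
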